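(* Let $q\geqslant2$ be an even integer and $n\geqslant1$. There is no self-dual generalized bent function $f:\mathbb{F}_2^n\to\mathbb{Z}_q$ of the form $f(x)=\sum_{i=1}^n\lambda_ix_i+\lambda_0$ with $\lambda_0,\lambda_1,\dots,\lambda_n\in\mathbb{Z}_q$.
   Context: $x_i\in\{0,1\}$ are treated as integers in the sum. $\omega=e^{2\pi i/q}$, $H_f(y)=\sum_x\omega^{f(x)}(-1)^{\langle x,y\rangle}$ with $\langle x,y\rangle=\bigoplus_ix_iy_i$. $f$ is self-dual generalized bent if $H_f(y)=2^{n/2}\omega^{f(y)}$ for all $y\in\mathbb{F}_2^n$. *)

(* Defs.v *)
From mathcomp Require Export all_boot all_order all_algebra.
From mathcomp Require Export complex.
From mathcomp Require Export reals exp trigo.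

Set Implicit Arguments.
Unset Strict Implicit.
Unset Printing Implicit Defensive.

Import Order.TTheory GRing.Theory Num.Theory.

Local Open Scope ring_scope.
Local Open Scope complex_scope.

(* e^{2 pi i / q}, by Euler's formula *)
Definition omega (R : realType) (q : nat) : R[i] :=
  cos (2 * pi / q%:R) +i* sin (2 * pi / q%:R).

Definition dotF2 (n : nat) (x y : 'rV['F_2]_n) : 'F_2 :=
  \sum_(i < n) x 0 i * y 0 i.

(* Elements of 'Z_q and 'F_2 used as exponents are coerced to their
   representatives in {0, ..., q - 1} and {0, 1}. For q < 2 the type 'Z_q is
   the ring of integers mod 2, so f is a function into Z/q only when 1 < q. *)
Definition gWalsh (R : realType) (q n : nat) (f : 'rV['F_2]_n -> 'Z_q)
    (y : 'rV['F_2]_n) : R[i] :=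
  \sum_(x : 'rV['F_2]_n) omega R q ^+ (f x : nat) * (-1) ^+ (dotF2 x y : nat).

Definition self_dual_gbent (R : realType) (q n : nat)
    (f : 'rV['F_2]_n -> 'Z_q) : Prop :=
  forall y : 'rV['F_2]_n,
    gWalsh R f y = (2 `^ (n%:R / 2))%:C * omega R q ^+ (f y : nat).

(* The coordinate x_i is lifted from F_2 to the integer 0 or 1 before it
   multiplies lam i, and the sum is taken in Z/q. *)
Definition affine_form (q n : nat) (lam : 'I_n -> 'Z_q) (lam0 : 'Z_q)
    (x : 'rV['F_2]_n) : 'Z_q :=
  \sum_(i < n) lam i *+ (x 0 i : nat) + lam0.

(* Main.v *)
(** Flipping the j-th coordinate of x multiplies [omega ^+ f x] by
    [u = omega ^+ lam j]. Hence, with A the part of the Walsh sum over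
    [x_j = 0], the transform is [A * (1 + u)] at 0 and [A * (1 - u)] at e_j.
    Self-duality makes the second value u times the nonzero first one, so
    [1 - u = u * (1 + u)]; multiplying by the conjugate of u, which is its
    inverse, gives [u^* - u = 2], whose left-hand side is purely imaginary. *)

Require Import Defs.
From mathcomp Require Import lra.

Set Implicit Arguments.
Unset Strict Implicit.
Unset Printing Implicit Defensive.

Import Order.TTheory GRing.Theory Num.Theory.
Local Open Scope ring_scope.
Local Open Scope complex_scope.

Section Omega.
Variable R : realType.

Lemma de_moivre (a : R) (n : nat) :
  (cos a +i* sin a) ^+ n = cos (a *+ n) +i* sin (a *+ n).
Proof.
elim: n => [|n IHn]; first by rewrite !mulr0n cos0 sin0.
rewrite exprS IHn !mulrS cosD sinD; apply/eqP; rewrite eq_complex /=.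
by rewrite eqxx [X in _ == X]addrC eqxx.
Qed.

Lemma omega_expq (q : nat) : (0 < q)%N -> omega R q ^+ q = 1.
Proof.
move=> q_gt0; rewrite /omega de_moivre.
rewrite -[_ *+ q]mulr_natr divfK ?pnatr_eq0 -?lt0n //.
by rewrite mulrC mulr_natr cos2pi sin2pi.
Qed.

Lemma omega_mul_conj (q : nat) : omega R q * (omega R q)^* = 1.
Proof.
rewrite /omega; apply/eqP; rewrite eq_complex /=.
by rewrite mulrN opprK -!expr2 cos2Dsin2 mulrN mulrC addNr !eqxx.
Qed.

(** Adding in ['Z_q] reduces the exponent modulo q, which is harmless because [omega] has q-th power
    1; [1 < q] makes q the actual modulus of ['Z_q]. *)
Lemma omega_expD (q : nat) (a b : 'Z_q) : (1 < q)%N ->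
  omega R q ^+ ((a + b)%R : 'Z_q) = omega R q ^+ a * omega R q ^+ b.
Proof.
move=> q_gt1; rewrite -exprD /= expr_mod //.
by rewrite (Zp_cast q_gt1) omega_expq // ltnW.
Qed.

End Omega.

Lemma unimodular_neq (R : realType) (u : R[i]) :
  u * u^* = 1 -> 1 - u != u * (1 + u).
Proof.
case: u => a b /eqP; rewrite eq_complex /= => /andP[/eqP h1 _].
apply/negP; rewrite eq_complex /= => /andP[/eqP h2 /eqP h3].
(* The imaginary parts give b(1 + a) = 0, which with a^2 + b^2 = 1 forces b = 0 and a = 1 or -1; the
   real parts would then require a = 0. *)
by nra.
Qed.

Section AffineFlip.
Variables (q n : nat) (lam : 'I_n -> 'Z_q) (lam0 : 'Z_q) (j : 'I_n).

Lemma affine_form0 : affine_form lam lam0 0 = lam0.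
Proof.
by rewrite /affine_form big1 ?add0r // => i _; rewrite mxE mulr0n.
Qed.

(** The lift from F_2 to integers is not additive, since 1 + 1 lifts to 0; starting from
    [x 0 j = 0], the lifted coordinate does grow by 1. *)
Lemma affine_form_flip (x : 'rV['F_2]_n) : x 0 j = 0 ->
  affine_form lam lam0 (x + delta_mx 0 j) = affine_form lam lam0 x + lam j.
Proof.
move=> xj0; rewrite /affine_form addrAC; congr (_ + _).
rewrite (bigD1 j) //= [in RHS](bigD1 j) //= !mxE !eqxx xj0 mulr0n add0r.
rewrite add0r mulr1n addrC; congr (_ + _); apply: eq_bigr => i ij.
by rewrite !mxE eqxx (negPf ij) addr0.
Qed.

End AffineFlip.

Lemma dotF2_0r (n : nat) (x : 'rV['F_2]_n) : dotF2 x 0 = 0.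
Proof. by rewrite /dotF2 big1 // => i _; rewrite mxE mulr0. Qed.

Lemma dotF2_delta (n : nat) (x : 'rV['F_2]_n) (j : 'I_n) :
  dotF2 x (delta_mx 0 j) = x 0 j.
Proof.
rewrite /dotF2 (bigD1 j) //= mxE !eqxx mulr1 big1 ?addr0 // => i ij.
by rewrite mxE (negPf ij) andbF mulr0.
Qed.

Lemma F2_add1_neq0 (a : 'F_2) : (a + 1 != 0) = (a == 0).
Proof. by case: a => -[|[|]]. Qed.

(** Translation by e_j carries the half-cube x_j = 0 bijectively onto x_j = 1. *)
Lemma sum_rV_flip (V : nmodType) (n : nat) (F : 'rV['F_2]_n -> V) (j : 'I_n) :
  \sum_(x : 'rV_n) F x =
  \sum_(x : 'rV_n | x 0 j == 0) (F x + F (x + delta_mx 0 j)).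
Proof.
rewrite big_split (bigID (fun x : 'rV_n => x 0 j == 0)) /=; congr (_ + _).
rewrite (reindex_inj (addIr (delta_mx 0 j))) /=; apply: eq_bigl => x.
by rewrite !mxE !eqxx F2_add1_neq0.
Qed.

Section WalshFlip.
Variables (R : realType) (q n : nat) (f : 'rV['F_2]_n -> 'Z_q).
Variables (j : 'I_n) (l : 'Z_q).
Hypothesis q_gt1 : (1 < q)%N.
Hypothesis f_flip :
  forall x : 'rV_n, x 0 j = 0 -> f (x + delta_mx 0 j) = f x + l.

Let A : R[i] := \sum_(x : 'rV_n | x 0 j == 0) omega R q ^+ f x.

Lemma gWalsh0_flip : gWalsh R f 0 = A * (1 + omega R q ^+ l).
Proof.
rewrite /gWalsh (sum_rV_flip _ j) mulr_suml; apply: eq_bigr => x /eqP xj0.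
by rewrite !dotF2_0r !expr0 !mulr1 f_flip // omega_expD // mulrDr mulr1.
Qed.

(** At e_j the sign is (-1)^(x_j), so the two members of each flipped pair enter with opposite
    signs. *)
Lemma gWalsh_delta_flip :
  gWalsh R f (delta_mx 0 j) = A * (1 - omega R q ^+ l).
Proof.
rewrite /gWalsh (sum_rV_flip _ j) mulr_suml; apply: eq_bigr => x /eqP xj0.
rewrite !dotF2_delta mxE xj0 mxE !eqxx add0r expr0 expr1 f_flip //.
by rewrite omega_expD // mulr1 mulrN1 mulrBr mulr1.
Qed.

End WalshFlip.

Theorem theorem5 (R : realType) (q n : nat)
    (hq : (2 <= q)%N) (hq_even : ~~ odd q) (hn : (1 <= n)%N) :
  ~ exists f : 'rV['F_2]_n -> 'Z_q,
      (exists (lam : 'I_n -> 'Z_q) (lam0 : 'Z_q),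
         forall x : 'rV['F_2]_n, f x = affine_form lam lam0 x) /\
      self_dual_gbent R f.
Proof.
case=> f [[lam [lam0 f_affine]] f_dual].
(* [hn] supplies a coordinate to flip, the one of index 0. *)
pose j : 'I_n := Ordinal hn.
have f_flip (x : 'rV_n) : x 0 j = 0 -> f (x + delta_mx 0 j) = f x + lam j.
  by move=> xj0; rewrite !f_affine affine_form_flip.
pose u := omega R q ^+ lam j.
have u_unit : u * u^* = 1.
  by rewrite /u rmorphXn -exprMn omega_mul_conj expr1n.
have H0 := f_dual 0; rewrite (gWalsh0_flip _ hq f_flip) in H0.
have H1 := f_dual (delta_mx 0 j); rewrite (gWalsh_delta_flip _ hq f_flip) in H1.
have f_delta : f (delta_mx 0 j) = f 0 + lam j.
  by rewrite -[delta_mx 0 j]add0r f_flip // mxE.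
rewrite f_delta omega_expD // mulrA -H0 -/u -mulrA in H1.
have omega_neq0 : omega R q != 0.
  apply: contra_eq_neq (omega_mul_conj R q) => ->.
  by rewrite mul0r eq_sym oner_eq0.
have /negP[] := unimodular_neq u_unit.
rewrite [u * _]mulrC; apply/eqP; apply: mulfI H1.
(* The factor A to be cancelled is nonzero because it divides the transform at 0, to which
   self-duality gives this value. *)
suff : (2 `^ (n%:R / 2))%:C * omega R q ^+ f 0 != 0.
  by rewrite -H0 mulf_eq0 negb_or => /andP[].
rewrite mulf_neq0 ?expf_neq0 // eq_complex /= eqxx andbT.
by rewrite gt_eqF // powR_gt0.
Qed.
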